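(* Let $M$ be a monoid, $A$ a right $M$-act and $E$ the endomorphism monoid of $A$. The following statements hold: a) If $A$ is a weak $*$-act then $A$ is weak self-projective. b) If $A$ is weak self-projective and indecomposable, then $A$ is a weak $*$-act.
   Context: For a monoid $M$, $[M^{\mathrm{op}},\mathcal{S}et]$ is the category of right $M$-acts: sets $X$ with an action $X\times M\to X$ such that $(xm)m'=x(mm')$ and $x1=x$ (the empty act is allowed), with equivariant maps; $[X,X']$ denotes the set of morphisms. All subcategories are full and closed under isomorphisms. With $E=[A,A]$, $A$ is an $E$-$M$-biact, and there are functors $H_A:[M^{\mathrm{op}},\mathcal{S}et]\to[E^{\mathrm{op}},\mathcal{S}et]$, $H_A(X)=[A,X]$, and its left adjoint $T_A:[E^{\mathrm{op}},\mathcal{S}et]\to[M^{\mathrm{op}},\mathcal{S}et]$, $T_A(Y)=Y\otimes_E A$ (the quotient of $Y\times A$ by the equivalence relation generated by $(ye,a)\sim(y,ea)$). Let $\delta:T_A\circ H_A\to\mathbf{1}$ and $\eta:\mathbf{1}\to H_A\circ T_A$ be the counit and unit. $\mathcal{C}_A$ is the full subcategory of $[M^{\mathrm{op}},\mathcal{S}et]$ of those $X$ such that for every morphism $\epsilon:U\to V$ of $M$-acts with $H_A(\epsilon)$ an isomorphism, $[X,\epsilon]:[X,U]\to[X,V]$ is bijective. $\mathcal{G}^A=\{Y\in[E^{\mathrm{op}},\mathcal{S}et]\mid\eta_Y\text{ is a monomorphism}\}$ and $\mathcal{S}^A=\{Y\in[E^{\mathrm{op}},\mathcal{S}et]\mid\eta_Y\text{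 is an isomorphism}\}$. $A$ is a weak $*$-act if the adjoint pair induces mutually inverse equivalences $H_A:\mathcal{C}_A\rightleftarrows\mathcal{G}^A:T_A$ (i.e. $H_A$ and $T_A$ restrict to functors between these subcategories which are mutually quasi-inverse equivalences). $A$ is weak self-projective if $(H_A\circ T_A)(g)$ is an epimorphism whenever $g:U\to Y$ is an epimorphism in $[E^{\mathrm{op}},\mathcal{S}et]$ with $U\in\mathcal{S}^A$. $A$ is decomposable if there are two non-empty subacts $B,C\subseteq A$ with $A=B\cup C$ and $B\cap C=\emptyset$; otherwise $A$ is indecomposable.
   Formalization: Part b) additionally assumes that A is non-empty: the empty act is weak self-projective and, by the given definition, indecomposable, but it is not a weak *-act, since the empty E-act lies in G^A while H_A(T_A) of it is a point. *)

(* Defs.v *)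
From HB Require Import structures.
From mathcomp Require Import all_boot.
From mathcomp Require Import monoid generic_quotient boolp.
From Stdlib Require Import Relation_Operators.

Set Implicit Arguments.
Unset Strict Implicit.
Unset Printing Implicit Defensive.

Import Algebra.
Local Open Scope group_scope.
Local Open Scope quotient_scope.

Record act (M : monoidType) := Act {
  act_sort :> Type;
  actm : act_sort -> M -> act_sort;
  actmM : forall x m m', actm (actm x m) m' = actm x (m * m');
  actm1 : forall x, actm x 1 = x
}.
Arguments actm {M a} x m.
Arguments Act {M act_sort actm}.

Notation "x • m" := (actm x m) (at level 40, left associativity).

Record hom (M : monoidType) (X Y : act M) := Hom {
  hom_fun :> X -> Y;
  homE : forall x m, hom_fun (x • m) = hom_fun x • m
}.
Arguments Hom {M X Y hom_fun}.

Lemma hom_ext (M : monoidType) (X Y : act M) (f g : hom X Y) :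
  f =1 g -> f = g.
Proof.
case: f g => [f fE] [g gE] /= /funext fg; case: _ / fg in gE *.
by congr Hom; apply: Prop_irrelevance.
Qed.

Section Category.
Variable M : monoidType.
Implicit Types X Y Z : act M.

Definition hom_id X : hom X X := @Hom M X X id (fun x m => erefl).

Fact hom_comp_subproof X Y Z (g : hom Y Z) (f : hom X Y) x m :
  (g \o f) (x • m) = (g \o f) x • m.
Proof. by rewrite /= !homE. Qed.

Definition hom_comp X Y Z (g : hom Y Z) (f : hom X Y) : hom X Z :=
  Hom (hom_comp_subproof g f).

Definition is_mono X Y (f : hom X Y) : Prop :=
  forall Z (g h : hom Z X), hom_comp f g = hom_comp f h -> g = h.

Definition is_epi X Y (f : hom X Y) : Prop :=
  forall Z (g h : hom Y Z), hom_comp g f = hom_comp h f -> g = h.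

Definition is_iso X Y (f : hom X Y) : Prop :=
  exists2 g : hom Y X, hom_comp g f = hom_id X & hom_comp f g = hom_id Y.

Definition is_subact X (B : X -> Prop) : Prop :=
  forall x m, B x -> B (x • m).

Definition decomposable X : Prop :=
  exists B C : X -> Prop,
    [/\ is_subact B, is_subact C, exists b, B b & exists c, C c] /\
    (forall x, B x \/ C x) /\ (forall x, ~ (B x /\ C x)).

(* In this sense the empty act is indecomposable. *)
Definition indecomposable X : Prop := ~ decomposable X.

End Category.

Record act_functor (M N : monoidType) := ActFunctor {
  fobj :> act M -> act N;
  fmap : forall X Y, hom X Y -> hom (fobj X) (fobj Y);
  fmap_id : forall X, fmap (hom_id X) = hom_id (fobj X);
  fmap_comp : forall X Y Z (g : hom Y Z) (f : hom X Y),
    fmap (hom_comp g f) = hom_comp (fmap g) (fmap f)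
}.
Arguments fmap {M N} F {X Y} f : rename.
Arguments ActFunctor {M N fobj fmap}.

Definition functor_id (M : monoidType) : act_functor M M :=
  @ActFunctor M M id (fun X Y f => f) (fun X => erefl) (fun X Y Z g f => erefl).

Section FunctorComp.
Variables (M N P : monoidType) (G : act_functor N P) (F : act_functor M N).

Fact functor_comp_id X : fmap G (fmap F (hom_id X)) = hom_id (G (F X)).
Proof. by rewrite !fmap_id. Qed.

Fact functor_comp_comp X Y Z (g : hom Y Z) (f : hom X Y) :
  fmap G (fmap F (hom_comp g f)) =
  hom_comp (fmap G (fmap F g)) (fmap G (fmap F f)).
Proof. by rewrite !fmap_comp. Qed.

Definition functor_comp : act_functor M P :=
  @ActFunctor M P (fun X => G (F X)) (fun X Y f => fmap G (fmap F f))
    functor_comp_id functor_comp_comp.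

End FunctorComp.

(* Predicates on objects stand for full subcategories. *)

Definition restricts (M N : monoidType) (F : act_functor M N)
    (C : act M -> Prop) (D : act N -> Prop) : Prop :=
  forall X, C X -> D (F X).

Definition nat_iso_on (M N : monoidType) (C : act M -> Prop)
    (F G : act_functor M N) : Prop :=
  exists theta : forall X, C X -> hom (F X) (G X),
    (forall X (CX : C X), is_iso (theta X CX)) /\
    (forall X Y (CX : C X) (CY : C Y) (f : hom X Y),
       hom_comp (theta Y CY) (fmap F f) = hom_comp (fmap G f) (theta X CX)).

Definition mutually_inverse_equivalences (M N : monoidType)
    (F : act_functor M N) (G : act_functor N M)
    (C : act M -> Prop) (D : act N -> Prop) : Prop :=
  [/\ restricts F C D,
      restricts G D C,
      nat_iso_on C (functor_comp G F) (functor_id M)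
    & nat_iso_on D (functor_comp F G) (functor_id N)].

Section Adjunction.
Variables (M : monoidType) (A : act M).

Definition End : Type := hom A A.

HB.instance Definition _ := gen_eqMixin End.
HB.instance Definition _ := gen_choiceMixin End.

Fact End_mulA : associative (@hom_comp M A A A : End -> End -> End).
Proof. by move=> f g h; apply: hom_ext. Qed.
Fact End_mul1 : left_id (hom_id A : End) (@hom_comp M A A A).
Proof. by move=> f; apply: hom_ext. Qed.
Fact End_1mul : right_id (hom_id A : End) (@hom_comp M A A A).
Proof. by move=> f; apply: hom_ext. Qed.

HB.instance Definition _ := isMonoid.Build End End_mulA End_mul1 End_1mul.

Implicit Types (X : act M) (Y : act End).

(* The action of E on [A, X] is precomposition. *)
Definition H_act X (f : hom A X) (e : End) : hom A X := hom_comp f e.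

Fact H_actM X f (e e' : End) : H_act (@H_act X f e) e' = H_act f (e * e').
Proof. exact: hom_ext. Qed.
Fact H_act1 X f : @H_act X f 1 = f.
Proof. exact: hom_ext. Qed.

Definition H_obj X : act End := Act (@H_actM X) (@H_act1 X).

Definition H_map_fun X X' (u : hom X X') : H_obj X -> H_obj X' := hom_comp u.

Fact H_mapE X X' (u : hom X X') f e : H_map_fun u (f • e) = H_map_fun u f • e.
Proof. exact: hom_ext. Qed.

Definition H_map X X' (u : hom X X') : hom (H_obj X) (H_obj X') :=
  Hom (H_mapE u).

Fact H_map_id X : H_map (hom_id X) = hom_id (H_obj X).
Proof. by apply: hom_ext => f; apply: hom_ext. Qed.
Fact H_map_comp X X' X'' (v : hom X' X'') (u : hom X X') :
  H_map (hom_comp v u) = hom_comp (H_map v) (H_map u).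
Proof. by apply: hom_ext => f; apply: hom_ext. Qed.

Definition H_functor : act_functor M End := ActFunctor H_map_id H_map_comp.

(* The left action of E on A is evaluation: e a = e(a). *)
Inductive tensor_step Y : Y * A -> Y * A -> Prop :=
  TensorStep (y : Y) (e : End) (a : A) : tensor_step (y • e, a) (y, e a).

Definition tensor_eq Y : rel {classic Y * A} :=
  fun p q => `[< clos_refl_sym_trans _ (@tensor_step Y) p q >].

Fact tensor_eq_refl Y : reflexive (@tensor_eq Y).
Proof. by move=> p; apply/asboolP/rst_refl. Qed.
Fact tensor_eq_sym Y : symmetric (@tensor_eq Y).
Proof.
by move=> p q; apply/idP/idP => /asboolP pq; apply/asboolP/rst_sym.
Qed.
Fact tensor_eq_trans Y : transitive (@tensor_eq Y).
Proof.
move=> q p r /asboolP pq /asboolP qr; apply/asboolP; exact: rst_trans pq qr.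
Qed.

Canonical tensor_equiv Y :=
  EquivRel (@tensor_eq Y) (@tensor_eq_refl Y) (@tensor_eq_sym Y)
           (@tensor_eq_trans Y).

Definition tensor Y : Type := {eq_quot (tensor_equiv Y)}.

Definition tens Y (y : Y) (a : A) : tensor Y :=
  \pi_({eq_quot (tensor_equiv Y)}) ((y, a) : {classic Y * A}).

Lemma tensP Y (t : tensor Y) : exists y a, t = tens y a.
Proof.
exists (repr t).1, (repr t).2; rewrite /tens -surjective_pairing.
by rewrite [RHS]reprK.
Qed.

Lemma tens_eqP Y (y y' : Y) (a a' : A) :
  tens y a = tens y' a' <->
  clos_refl_sym_trans _ (@tensor_step Y) (y, a) (y', a').
Proof.
by split=> [/eqmodP/asboolP //|yy']; apply/eqmodP/asboolP.
Qed.

Lemma tens_act Y (y : Y) (e : End) (a : A) : tens (y • e) a = tens y (e a).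
Proof. by apply/tens_eqP/rst_step. Qed.

Definition tensor_lift Y (T : Type) (f : Y -> A -> T) (t : tensor Y) : T :=
  f (repr t).1 (repr t).2.

Lemma tensor_liftE Y T (f : Y -> A -> T) :
  (forall y (e : End) a, f (y • e) a = f y (e a)) ->
  forall y a, tensor_lift f (tens y a) = f y a.
Proof.
move=> fE y a; rewrite /tensor_lift.
have : clos_refl_sym_trans _ (@tensor_step Y) (repr (tens y a)) (y, a).
  by apply/asboolP/(eqmodP (tensor_equiv Y)); rewrite reprK.
move: (repr _) => p; set q := (y, a); rewrite -[a]/q.2 -[y]/q.1.
by elim=> {p q y a} [_ _ [] | | p q _ -> | p q r _ -> _ ->] //=.
Qed.

Definition T_act Y (t : tensor Y) (m : M) : tensor Y :=
  tensor_lift (fun y a => tens y (a • m)) t.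

Lemma T_actE Y (y : Y) a m : T_act (tens y a) m = tens y (a • m).
Proof. by apply: tensor_liftE => {}y e {}a; rewrite tens_act homE. Qed.

Fact T_actM Y (t : tensor Y) m m' : T_act (T_act t m) m' = T_act t (m * m').
Proof. by have [y [a ->]] := tensP t; rewrite !T_actE actmM. Qed.
Fact T_act1 Y (t : tensor Y) : T_act t 1 = t.
Proof. by have [y [a ->]] := tensP t; rewrite T_actE actm1. Qed.

Definition T_obj Y : act M := Act (@T_actM Y) (@T_act1 Y).

Definition T_map_fun Y Y' (g : hom Y Y') : T_obj Y -> T_obj Y' :=
  tensor_lift (fun y a => tens (g y) a).

Lemma T_map_funE Y Y' (g : hom Y Y') y a :
  T_map_fun g (tens y a) = tens (g y) a.
Proof. by apply: tensor_liftE => {}y e {}a; rewrite homE tens_act. Qed.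

Fact T_mapE Y Y' (g : hom Y Y') t m : T_map_fun g (t • m) = T_map_fun g t • m.
Proof.
have [y [a ->]] := tensP t.
by rewrite /= T_actE !T_map_funE T_actE.
Qed.

Definition T_map Y Y' (g : hom Y Y') : hom (T_obj Y) (T_obj Y') :=
  Hom (T_mapE g).

Fact T_map_id Y : T_map (hom_id Y) = hom_id (T_obj Y).
Proof. by apply: hom_ext => t; have [y [a ->]] := tensP t; apply: T_map_funE. Qed.
Fact T_map_comp Y Y' Y'' (h : hom Y' Y'') (g : hom Y Y') :
  T_map (hom_comp h g) = hom_comp (T_map h) (T_map g).
Proof.
apply: hom_ext => t; have [y [a ->]] := tensP t.
by rewrite /= !T_map_funE.
Qed.

Definition T_functor : act_functor End M := ActFunctor T_map_id T_map_comp.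

Fact unit_subproof Y (y : Y) a m :
  (tens y (a • m) : T_obj Y) = (tens y a : T_obj Y) • m.
Proof. by rewrite /= T_actE. Qed.

Definition unit_fun Y (y : Y) : H_functor (T_functor Y) :=
  @Hom M A (T_obj Y) (fun a => tens y a) (unit_subproof y).

Fact unitE Y (y : Y) e : unit_fun (y • e) = unit_fun y • e.
Proof. by apply: hom_ext => a; apply: tens_act. Qed.

Definition adj_unit Y : hom Y (H_functor (T_functor Y)) := Hom (@unitE Y).

Definition counit_fun X : T_functor (H_functor X) -> X :=
  @tensor_lift (H_functor X) X (fun (f : hom A X) a => f a).

Lemma counit_funE X (f : H_functor X) a :
  @counit_fun X (tens f a) = (f : hom A X) a.
Proof. exact: tensor_liftE. Qed.

Fact counitE X t m : @counit_fun X (t • m) = counit_fun t • m.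
Proof.
by have [f [a ->]] := tensP t; rewrite /= T_actE !counit_funE homE.
Qed.

Definition adj_counit X : hom (T_functor (H_functor X)) X := Hom (@counitE X).

Lemma adj_unit_nat Y Y' (g : hom Y Y') :
  hom_comp (adj_unit Y') g =
  hom_comp (fmap H_functor (fmap T_functor g)) (adj_unit Y).
Proof.
by apply: hom_ext => y; apply: hom_ext => a; rewrite /= T_map_funE.
Qed.

Lemma adj_counit_nat X X' (u : hom X X') :
  hom_comp u (adj_counit X) =
  hom_comp (adj_counit X') (fmap T_functor (fmap H_functor u)).
Proof.
apply: hom_ext => t; have [f [a ->]] := tensP t.
by rewrite /= T_map_funE !counit_funE.
Qed.

Lemma adj_triangleT Y :
  hom_comp (adj_counit (T_functor Y)) (fmap T_functor (adj_unit Y)) =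
  hom_id (T_functor Y).
Proof.
apply: hom_ext => t; have [y [a ->]] := tensP t.
by rewrite /= T_map_funE counit_funE.
Qed.

Lemma adj_triangleH X :
  hom_comp (fmap H_functor (adj_counit X)) (adj_unit (H_functor X)) =
  hom_id (H_functor X).
Proof.
by apply: hom_ext => f; apply: hom_ext => a; rewrite /= counit_funE.
Qed.

Definition in_C X : Prop :=
  forall (U V : act M) (eps : hom U V), is_iso (fmap H_functor eps) ->
    bijective (fun f : hom X U => hom_comp eps f).

Definition in_G Y : Prop := is_mono (adj_unit Y).

Definition in_S Y : Prop := is_iso (adj_unit Y).

Definition weak_star_act : Prop :=
  mutually_inverse_equivalences H_functor T_functor in_C in_G.

Definition weak_self_projective : Prop :=
  forall (U Y : act End) (g : hom U Y), in_S U -> is_epi g ->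
    is_epi (fmap (functor_comp H_functor T_functor) g).

End Adjunction.

(* Main.v *)
Require Import Defs.
From mathcomp Require Import all_boot monoid.
From mathcomp Require Import boolp.

(* The functor T takes values in C_A and any subact of an act H X lies in G^A,
   so only the invertibility of the unit on G^A (and, as a consequence, of the
   counit on C_A) is at stake.

   a) Any natural isomorphism HT -> 1 on G^A makes the unit itself invertible
   on G^A.  The image Y' of the unit of Y is a subact of HTY, hence lies in G^A,
   and T Y -> T Y' is injective; so the unit of Y is onto for every Y, and
   HT(g) inherits surjectivity from g by naturality of the unit.

   b) Cover Y by the free act U = Y x E.  Then TU is a disjoint union of copies
   of A, and a map from A to it lands in a single copy because A is
   indecomposable; thus U is in S^A, HT(U -> Y) is onto and so is the unit of Y.
   The unit of H X is split mono, hence invertible, so H inverts the counit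
   of X, and objects of C_A see such morphisms as isomorphisms. *)

Set Implicit Arguments.
Unset Strict Implicit.
Unset Printing Implicit Defensive.

Import Algebra.
Local Open Scope group_scope.

(** * Monomorphisms, epimorphisms, isomorphisms and images of acts *)

Section Acts.
Variable M : monoidType.
Implicit Types X Y Z : act M.

Lemma eq_hom X Y (f g : hom X Y) : f = g -> f =1 g.
Proof. by move->. Qed.

Lemma hom_comp_eq X Y Y' Z (g : hom Y Z) (f : hom X Y) (g' : hom Y' Z)
    (f' : hom X Y') :
  hom_comp g f = hom_comp g' f' -> forall x, g (f x) = g' (f' x).
Proof. by move=> /eq_hom gf x; apply: (gf x). Qed.

Lemma hom_cancel X Y (g : hom Y X) (f : hom X Y) :
  hom_comp g f = hom_id X -> cancel f g.
Proof. by move=> /eq_hom gf x; apply: (gf x). Qed.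

Definition regular_act : act M :=
  @Act M M (fun x m => x * m) (fun x m n => esym (mulgA x m n)) (@mulg1 M).

Definition orbit_map X (x : X) : hom regular_act X :=
  @Hom M regular_act X (fun m => x • m) (fun m n => esym (actmM x m n)).

(** Points of X are maps out of the regular act, so a mono can be tested on orbit maps. *)
Lemma mono_inj X Y (f : hom X Y) : is_mono f -> injective f.
Proof.
move=> f_mono x y fxy.
have /eq_hom/(_ 1) : orbit_map x = orbit_map y.
  by apply: f_mono; apply: hom_ext => m; rewrite /= !homE fxy.
by rewrite /= !actm1.
Qed.

Lemma inj_mono X Y (f : hom X Y) : injective f -> is_mono f.
Proof.
by move=> f_inj Z g h /eq_hom fgh; apply: hom_ext => z; apply/f_inj/fgh.
Qed.

Lemma surj_epi X Y (f : hom X Y) : (forall y, exists x, f x = y) -> is_epi f.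
Proof.
move=> f_surj Z g h /eq_hom ghf; apply: hom_ext => y.
by have [x <-] := f_surj y; apply: ghf.
Qed.

(* The predicates on M receive the characteristic map of every subact, which
   separates a proper subact from the whole act. *)
Fact pred_actM (P : M -> Prop) m m' :
  (fun n => P (m * (m' * n))) = (fun n => P (m * m' * n)).
Proof. by apply: funext => n; rewrite mulgA. Qed.

Fact pred_act1 (P : M -> Prop) : (fun n => P (1 * n)) = P.
Proof. by apply: funext => n; rewrite mul1g. Qed.

Definition pred_act : act M :=
  @Act M (M -> Prop) (fun P m n => P (m * n)) pred_actM pred_act1.

Fact image_char_subproof X Y (f : hom X Y) y m :
  (fun n => exists x, f x = y • m • n) =
  (fun n => exists x, f x = y • (m * n)).
Proof. by apply: funext => n; rewrite actmM. Qed.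

Definition image_char X Y (f : hom X Y) : hom Y pred_act :=
  @Hom M Y pred_act (fun y n => exists x, f x = y • n)
    (image_char_subproof f).

Definition true_map X : hom X pred_act :=
  @Hom M X pred_act (fun _ _ => True) (fun _ _ => erefl).

Lemma epi_surj X Y (f : hom X Y) : is_epi f -> forall y, exists x, f x = y.
Proof.
move=> f_epi y.
have /eq_hom/(_ y)/(congr1 (fun P => P 1)) : image_char f = true_map Y.
  apply: f_epi; apply: hom_ext => x /=; apply: funext => n.
  by apply/propext; split=> // _; exists (x • n); rewrite homE.
by rewrite /= actm1 => ->.
Qed.

Lemma iso_inj X Y (f : hom X Y) : is_iso f -> injective f.
Proof. by case=> g /hom_cancel gK _; apply: can_inj gK. Qed.

Lemma iso_surj X Y (f : hom X Y) : is_iso f -> forall y, exists x, f x = y.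
Proof. by case=> g _ /hom_cancel fK y; exists (g y). Qed.

Lemma bij_iso X Y (f : hom X Y) :
  injective f -> (forall y, exists x, f x = y) -> is_iso f.
Proof.
move=> f_inj f_surj; pose g y := sval (cid (f_surj y)).
have gK y : f (g y) = y := svalP (cid (f_surj y)).
have gE y m : g (y • m) = g y • m by apply: f_inj; rewrite homE !gK.
by exists (Hom gE); apply: hom_ext => x //=; apply: f_inj; apply: gK.
Qed.

Section Image.
Variables (X Y : act M) (f : hom X Y).

Definition image_sort : Type := {y : Y | exists x, f x = y}.

Fact image_stable (u : image_sort) m : exists x, f x = sval u • m.
Proof. by case: u => _ /= [x <-]; exists (x • m); rewrite homE. Qed.

Definition image_op (u : image_sort) m : image_sort := exist _ _ (image_stable u m).

Fact image_opM u m m' : image_op (image_op u m) m' = image_op u (m * m').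
Proof. by apply: eq_exist; rewrite /= actmM. Qed.

Fact image_op1 u : image_op u 1 = u.
Proof. by case: u => y ?; apply: eq_exist; rewrite /= actm1. Qed.

Definition image : act M := Act image_opM image_op1.

Definition image_incl : hom image Y :=
  @Hom M image Y (fun u => sval u) (fun _ _ => erefl).

Fact image_proj_subproof x m :
  exist (fun y => exists x, f x = y) (f (x • m)) (ex_intro _ _ erefl) =
  image_op (exist _ (f x) (ex_intro _ _ erefl)) m.
Proof. by apply: eq_exist; rewrite /= homE. Qed.

Definition image_proj : hom X image := @Hom M X image _ image_proj_subproof.

Lemma image_incl_inj : injective image_incl.
Proof. by case=> [y ?] [z ?] /= yz; apply: eq_exist. Qed.

Lemma image_proj_surj u : exists x, image_proj x = u.
Proof. by case: u => y [x fx]; exists x; apply: eq_exist. Qed.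

End Image.

(* [theta \o eta] is a natural endomorphism of the identity of C, so it commutes
   with its own retractions. *)
Lemma nat_iso_unit_surj (C : act M -> Prop) (F : act_functor M M)
    (eta : forall Y, hom Y (F Y)) :
  (forall Y Z (g : hom Y Z),
     hom_comp (eta Z) g = hom_comp (fmap F g) (eta Y)) ->
  nat_iso_on C F (functor_id M) ->
  forall Y (r : hom (F Y) Y), C Y -> hom_comp r (eta Y) = hom_id Y ->
  forall z, exists y, eta Y y = z.
Proof.
move=> eta_nat [theta [theta_iso theta_nat]] Y r CY rK.
have [k kK thetaK] := theta_iso Y CY.
pose s := hom_comp (theta Y CY) (eta Y); pose q := hom_comp r k.
have s_nat (f : hom Y Y) : s \o f =1 f \o s.
  move=> y; rewrite /s /= (hom_comp_eq (eta_nat _ _ f)).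
  exact: (hom_comp_eq (theta_nat _ _ CY CY f)).
have qs y : q (s y) = y.
  by rewrite /q /s /= (hom_cancel kK) (hom_cancel rK).
move=> z; exists (q (theta Y CY z)).
apply: (iso_inj (theta_iso Y CY)).
exact: etrans (s_nat q _) (qs _).
Qed.

End Acts.

(** * Where T and H take their values *)

Section Adjunction.
Variables (M : monoidType) (A : act M).
Local Notation E := (End A).
Local Notation H := (H_functor A).
Local Notation T := (T_functor A).
Implicit Types (X : act M) (Y : act E).

(** By adjunction, maps from T Y to V are maps from Y to H V, and H [eps] is invertible: [G]
    transposes, applies the inverse [k] and transposes back. *)
Lemma T_in_C Y : in_C A (T Y).
Proof.
move=> U V eps [k kK epsK].
pose G (g : hom (T Y) V) : hom (T Y) U :=
  hom_comp (adj_counit A U)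
    (fmap T (hom_comp k (hom_comp (fmap H g) (adj_unit Y)))).
have Hk h : hom_comp eps (k h) = h := hom_cancel epsK h.
have kH h : k (hom_comp eps h) = h := hom_cancel kK h.
exists G => f; apply: hom_ext => t; have [y [a ->]] := tensP t.
  rewrite /= T_map_funE counit_funE /=.
  have -> : H_map_fun (hom_comp eps f) (unit_fun y) =
            hom_comp eps (hom_comp f (unit_fun y)) by apply: hom_ext.
  by rewrite kH.
rewrite /= T_map_funE counit_funE /=.
exact: (eq_hom (Hk _) a).
Qed.

(** The counit after T [j] sends y ⊗ a to [j y a], so the unit at y determines [j y]. *)
Lemma sub_H_in_G Y X (j : hom Y (H X)) : injective j -> in_G Y.
Proof.
move=> j_inj; apply: inj_mono => y y' /eq_hom yy'; apply: j_inj.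
apply: hom_ext => a.
have := congr1 (adj_counit A X \o fmap T j) (yy' a).
by rewrite /= !T_map_funE !counit_funE.
Qed.

Lemma H_in_G X : in_G (H X).
Proof. exact: (@sub_H_in_G _ X (hom_id _)). Qed.

(** * From weak star act to weak self-projective *)

Lemma weak_star_unit_iso Y : weak_star_act A -> in_G Y -> in_S Y.
Proof.
case=> _ _ _ HT1 GY; apply: bij_iso (mono_inj GY) _.
have [theta [theta_iso theta_nat]] := HT1.
move=> z; have [k _ thetaK] := theta_iso Y GY.
(* The unit of H X has a retraction; the surjectivity obtained for X = T Y is
   transported to Y along theta. *)
have [w wz] := nat_iso_unit_surj (F := functor_comp H T) (@adj_unit_nat M A) HT1
  (@H_in_G (T Y)) (adj_triangleH A (T Y)) (fmap H (fmap T k) z).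
exists (theta Y GY w); rewrite [LHS](hom_comp_eq (adj_unit_nat (theta Y GY))).
move: wz => /= ->.
have := eq_hom (fmap_comp (functor_comp H T) (theta Y GY) k) z.
by rewrite thetaK fmap_id /= => <-.
Qed.

Lemma weak_star_unit_surj Y : weak_star_act A ->
  forall h, exists y, adj_unit Y y = h.
Proof.
move=> wA h; pose j := image_incl (adj_unit Y); pose p := image_proj (adj_unit Y).
have /(weak_star_unit_iso wA)/iso_surj/(_ (fmap H (fmap T p) h))[u] :=
  sub_H_in_G (@image_incl_inj _ _ _ (adj_unit Y)).
have [y <-] := image_proj_surj u; rewrite -/p => pyh; exists y.
(* Since [j] after [p] is the unit of Y, this is a triangle identity; it makes T [p] injective. *)
have pK t : adj_counit A (T Y) (fmap T j (fmap T p t)) = t.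
  have [y' [a ->]] := tensP t.
  by rewrite /= !T_map_funE counit_funE.
apply: hom_ext => a; rewrite -[LHS]pK -[RHS]pK; congr (adj_counit A _ (fmap T j _)).
by have /= <- := eq_hom pyh a; rewrite T_map_funE.
Qed.

Lemma weak_star_self_projective : weak_star_act A -> weak_self_projective A.
Proof.
move=> wA U Y g _ /epi_surj g_surj; apply: surj_epi => h.
have [y <-] := weak_star_unit_surj wA h; have [u <-] := g_surj y.
by exists (adj_unit U u); rewrite [RHS](hom_comp_eq (adj_unit_nat g)).
Qed.

(** * Free E-acts and their tensor product with A *)

Section FreeAct.
Variable S : Type.

Definition free_op (u : S * E) (e : E) : S * E := (u.1, u.2 * e).

Fact free_opM u e e' : free_op (free_op u e) e' = free_op u (e * e').
Proof. by rewrite /free_op /= mulgA. Qed.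

Fact free_op1 u : free_op u 1 = u.
Proof. by case: u => s e; rewrite /free_op /= mulg1. Qed.

Definition free_act : act E := Act free_opM free_op1.

(** As (s, e) ⊗ a = (s, 1) ⊗ e a, these coordinates present the tensor product as S copies of A. *)
Definition free_coord : tensor free_act -> S * A :=
  tensor_lift (fun (u : free_act) a => (u.1, u.2 a)).

Lemma free_coordE (u : free_act) a : free_coord (tens u a) = (u.1, u.2 a).
Proof. exact: tensor_liftE. Qed.

Lemma free_coordK :
  cancel free_coord (fun p => tens (Y := free_act) (p.1, 1) p.2).
Proof.
move=> t; have [[s e] [a ->]] := tensP t; rewrite free_coordE /=.
rewrite -(@tens_act _ _ free_act (s, 1)); congr tens.
by rewrite /= /free_op /= mul1g.
Qed.

Lemma free_coord_act (t : T free_act) m :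
  free_coord (t • m) = ((free_coord t).1, (free_coord t).2 • m).
Proof.
have [u [a ->]] := tensP t.
by rewrite -[_ • m]/(T_act _ m) T_actE !free_coordE homE.
Qed.

Lemma free_in_S : inhabited A -> indecomposable A -> in_S free_act.
Proof.
move=> [a0] indA; apply: bij_iso.
  move=> [s e] [s' e'] /eq_hom ss'.
  have eq_coord a := congr1 free_coord (ss' a).
  (* The index s is read off from a tensor, which takes a point of A. *)
  move: (eq_coord a0); rewrite /= !free_coordE /= => -[-> _].
  congr (_, _); apply: hom_ext => a.
  by move: (eq_coord a); rewrite /= !free_coordE /= => -[].
move=> /= h; pose c a := free_coord (h a).
have cE a m : c (a • m) = ((c a).1, (c a).2 • m).
  by rewrite /c homE free_coord_act.
(* Otherwise the points sharing the index of [a0] and the remaining ones would decompose A. *)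
have c1 a : (c a).1 = (c a0).1.
  apply: contrapT => ca; apply: indA.
  exists (fun x => (c x).1 = (c a0).1), (fun x => (c x).1 <> (c a0).1).
  split; last by split=> x; [apply: lem | case].
  by split=> [x m|x m||]; [rewrite cE | rewrite cE | exists a0 | exists a].
pose e : E := @Hom M A A (fun a => (c a).2) (fun a m => congr1 snd (cE a m)).
exists ((c a0).1, e); apply: hom_ext => a; apply: (can_inj free_coordK).
by rewrite [LHS]free_coordE -[RHS]/(c a) [RHS]surjective_pairing c1.
Qed.

End FreeAct.

Fact free_cover_subproof Y (u : free_act Y) (e : E) :
  (u • e).1 • (u • e).2 = u.1 • u.2 • e.
Proof. by rewrite actmM. Qed.

Definition free_cover Y : hom (free_act Y) Y := Hom (@free_cover_subproof Y).

Lemma free_cover_surj Y y : exists u, free_cover Y u = y.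
Proof. by exists (y, 1); apply: actm1. Qed.

(** * From weak self-projective to weak star act *)

Lemma self_projective_unit_surj Y :
  inhabited A -> indecomposable A -> weak_self_projective A ->
  forall h, exists y, adj_unit Y y = h.
Proof.
move=> A_inh indA wA h; have SU := free_in_S Y A_inh indA.
have /epi_surj/(_ h)[k <-] := wA _ _ _ SU (surj_epi (@free_cover_surj Y)).
have [u <-] := iso_surj SU k.
by exists (free_cover Y u); apply: (hom_comp_eq (adj_unit_nat _)).
Qed.

Lemma C_counit_iso X : in_C A X -> in_S (H X) -> is_iso (adj_counit A X).
Proof.
move=> CX [k kK etaK].
(* By a triangle identity H of the counit retracts the unit of H X, which is invertible. *)
have Hdelta_iso : is_iso (fmap H (adj_counit A X)).
  have deltaK := adj_triangleH A X.
  exists (adj_unit (H X)) => //; apply: hom_ext => t.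
  rewrite -[t](hom_cancel etaK).
  exact: (congr1 (adj_unit (H X)) (hom_cancel deltaK (k t))).
have [s _ sK] := CX _ _ _ Hdelta_iso.
exists (s (hom_id X)); last exact: sK.
(* The lifted identity is a section of the counit; it is a two-sided inverse because T (H X) lies in
   C_A, so composing with the counit is injective on its endomorphisms. *)
have delta_inj := bij_inj (@T_in_C (H X) _ _ _ Hdelta_iso).
apply: (delta_inj (hom_comp _ _) (hom_id _)).
apply: hom_ext => t; exact: (hom_cancel (sK (hom_id X))).
Qed.

Lemma self_projective_weak_star :
  inhabited A -> weak_self_projective A -> indecomposable A -> weak_star_act A.
Proof.
move=> A_inh wA indA.
have GS Y : in_G Y -> in_S Y.
  by move=> /mono_inj GY; apply: bij_iso => //; apply: self_projective_unit_surj.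
split=> [X _|Y _||]; first exact: H_in_G.
- exact: T_in_C.
- exists (fun X _ => adj_counit A X); split=> [X CX|X Y _ _ f].
    by apply: C_counit_iso => //; apply/GS/H_in_G.
  by rewrite -adj_counit_nat.
pose k Y GY := cid2 (GS Y GY).
exists (fun Y GY => s2val (k Y GY)); split=> [Y GY|Y Y' GY GY' f].
  by exists (adj_unit Y); [apply: (s2valP' (k Y GY)) | apply: (s2valP (k Y GY))].
(* Every [t] is a value of the unit, so naturality of the inverses reduces to that of the unit. *)
apply: hom_ext => t; rewrite -[t](hom_cancel (s2valP' (k Y GY))).
set y := s2val (k Y GY) t; have fy := hom_comp_eq (adj_unit_nat f) y.
apply: etrans (congr1 (s2val (k Y' GY')) (esym fy)) _.
rewrite (hom_cancel (s2valP (k Y' GY'))).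
by congr (f _); rewrite (hom_cancel (s2valP (k Y GY)) y).
Qed.

End Adjunction.

Theorem proposition5p2 (M : monoidType) (A : act M) :
  (weak_star_act A -> weak_self_projective A) /\
  (inhabited A -> weak_self_projective A -> indecomposable A ->
   weak_star_act A).
Proof.
split; [exact: weak_star_self_projective | exact: self_projective_weak_star].
Qed.
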